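(* Let $\mathcal{L}_0:\mathbb{R}^d\to\overline{\mathbb{R}}$ be the proper convex lower semicontinuous function defined by $\mathcal{L}_0(x)=\sup_{y\in\mathbb{R}^d}\big(\langle x,y\rangle-\sup_{l=0,1,\ldots,d}[\|y\|^{tn}_{(l)}-l]\big)$. Then $\mathcal{L}_0$ is characterized in each of the following ways. 1. By its epigraph: $$\mathrm{epi}\,\mathcal{L}_0=\overline{\mathrm{co}}\Big(\bigcup_{l=0}^{d}\mathbb{B}^{\star sn}_{(l)}\times[l,+\infty[\Big),$$ where $\mathbb{B}^{\star sn}_{(0)}=\{0\}$ by convention, and $\mathbb{B}^{\star sn}_{(1)}\subset\cdots\subset\mathbb{B}^{\star sn}_{(l-1)}\subset\mathbb{B}^{\star sn}_{(l)}\subset\cdots\subset\mathbb{B}^{\star sn}_{(d)}=\mathbb{B}$ are the unit balls of the $l$-support norms, $l=1,\ldots,d$. 2. $\mathcal{L}_0$ is the largest proper convex lower semicontinuous function below the function $L_0:\mathbb{R}^d\to\{0,1,\ldots,d\}\cup\{+\infty\}$ defined by $$L_0(x)=\begin{cases}0&\text{if }x=0,\\ l&\text{if }x\in\mathbb{B}^{\star sn}_{(l)}\setminus\mathbb{B}^{\star sn}_{(l-1)},\ l=1,\ldots,d,\\ +\infty&\text{if }x\notin\mathbb{B}^{\star sn}_{(d)}=\mathbb{B}.\end{cases}$$ 3. For all $x\in\mathbb{R}^d$, $$\mathcal{L}_0(x)=\min\Big\{\sum_{l=1}^{d}l\,\|x^{(l)}\|^{\star sn}_{(l)}\;:\;x^{(1)},\ldots,x^{(d)}\in\mathbb{R}^d,\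 \sum_{l=1}^{d}\|x^{(l)}\|^{\star sn}_{(l)}\leq 1,\ \sum_{l=1}^{d}x^{(l)}=x\Big\}.$$
   Context: $d\geq 1$ is an integer; $\mathbb{R}^d$ carries the scalar product $\langle\cdot,\cdot\rangle$ and the Euclidean norm $\|\cdot\|$; $\mathbb{B}=\{x:\|x\|\leq 1\}$; $\overline{\mathbb{R}}=[-\infty,+\infty]$. $\overline{\mathrm{co}}$ denotes the closed convex hull, $\mathrm{epi}\,f=\{(x,t)\in\mathbb{R}^d\times\mathbb{R}:f(x)\leq t\}$. A function is proper if it never takes the value $-\infty$ and is not identically $+\infty$. A minimum over an empty set equals $+\infty$. For $K\subset\{1,\ldots,d\}$, $x_K$ is the vector that coincides with $x$ on indices in $K$ and vanishes on indices outside $K$. For $k\in\{1,\ldots,d\}$ the top-$k$ norm is $\|x\|^{tn}_{(k)}=\sup_{|K|\leq k}\|x_K\|$ (supremum over subsets $K$ of $\{1,\ldots,d\}$), with the convention $\|\cdot\|^{tn}_{(0)}=0$. For $k\in\{1,\ldots,d\}$ the $k$-support norm is its dual norm $\|y\|^{\star sn}_{(k)}=\sup\{\langle x,y\rangle:\|x\|^{tn}_{(k)}\leq 1\}$, with unit ball $\mathbb{B}^{\star sn}_{(k)}=\{x:\|x\|^{\star sn}_{(k)}\leq 1\}$. *)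

(* Defs.v *)
From HB Require Import structures.
From mathcomp Require Export all_boot all_order all_algebra.
From mathcomp Require Export all_classical all_reals all_analysis.

Set Implicit Arguments.
Unset Strict Implicit.
Unset Printing Implicit Defensive.

Export Order.TTheory GRing.Theory Num.Theory.
Export numFieldNormedType.Exports.

Local Open Scope classical_set_scope.
Local Open Scope ring_scope.

Section convex_analysis.
Context {R : realType}.

Definition closed_convex_hull (E : normedModType R) (A : set E) : set E :=
  smallest [set B : set E | closed B /\ convex_set B] A.

(* m is the minimum of A, with the convention that min set0 = +oo *)
Definition is_min (A : set (\bar R)) (m : \bar R) :=
  (A !=set0 -> A m /\ lbound A m) /\ (A = set0 -> m = +oo%E).

Variable d : nat.
Implicit Types f : 'rV[R]_d -> \bar R.

Definition epi f : set ('rV[R]_d * R^o) := [set p | (f p.1 <= p.2%:E)%E].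

Definition proper_fun f := (forall x, f x != -oo%E) /\ (exists x, f x != +oo%E).

(* The library's convex_function is for real-valued functions; with infinite
   values, convexity is that of the epigraph. *)
Definition econvex f := convex_set (epi f).

End convex_analysis.

Section norms.
Context {R : realType} {d : nat}.
Implicit Types (x y : 'rV[R]_d) (K : {set 'I_d}) (k l : nat).

Definition dot x y : R := \sum_(i < d) x 0 i * y 0 i.

(* The library's norm `|x| on row vectors is the sup norm. *)
Definition enorm x : R := Num.sqrt (dot x x).

Definition enorm_ball : set 'rV[R]_d := [set x | enorm x <= 1].

Definition coord_restr K x : 'rV[R]_d := \row_i (if i \in K then x 0 i else 0).

(* For k = 0 only K = set0 qualifies, whence topk 0 x = 0. *)
Definition topk k x : R :=
  sup [set enorm (coord_restr K x) | K in [set K : {set 'I_d} | (#|K| <= k)%N]].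

(* Meaningful for 1 <= k only: the set is then bounded (sup is 0 on unbounded
   sets). *)
Definition ksupp k y : R := sup [set dot x y | x in [set x | topk k x <= 1]].

Definition ksupp_ball l : set 'rV[R]_d :=
  if l is 0%N then [set 0] else [set x | ksupp l x <= 1].

Definition calL0 x : \bar R :=
  ereal_sup [set (dot x y - sup [set topk l y - l%:R | l in `I_d.+1])%:E
            | y in [set: 'rV[R]_d]].

(* i : 'I_d stands for l = i.+1. As the balls are nested, at most one i
   qualifies, and for x != 0 none does exactly when x \notin ksupp_ball d. *)
Definition L0 x : \bar R :=
  if x == 0 then 0%E
  else if [pick i : 'I_d | x \in ksupp_ball i.+1 `\` ksupp_ball i] is Some i
  then (i.+1%:R)%:E else +oo%E.

End norms.

(* Main.v *)
(* Let E be the set of (x, t) for which x is a sum of vectors x^(l) with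
   sum_l |x^(l)|_(l) <= 1 and sum_l l |x^(l)|_(l) <= t, where |.|_(l) is the
   l-support norm. Everything follows from epi calL0 = E.
   The inclusion of E in epi calL0 is the duality inequality applied to each
   x^(l). For the converse, a point (x0, t0) outside the convex set E is
   separated from E by the hyperplane through its nearest point of E, which
   exists because the families (x^(l)) range over a compact set. As the
   l-support ball has support function the top-l norm, a non-vertical
   hyperplane directly gives a y such that <x0, y> - sup_l [|y|_l - l] > t0,
   with |.|_l the top-l norm; for a vertical one, y is rescaled to make the
   left-hand side arbitrarily large.
   Finally, dividing each x^(l) by its norm shows that any convex set containing
   the pieces B_(l) x [l, +oo[ contains E. *)
From mathcomp Require Import ring lra.
Require Import Defs.

Set Implicit Arguments.
Unset Strict Implicit.
Unset Printing Implicit Defensive.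

Local Open Scope classical_set_scope.
Local Open Scope ring_scope.

(** * Euclidean scalar product and norm *)

Section euclidean.
Context {R : realType} {d : nat}.
Implicit Types (x y z : 'rV[R]_d) (K : {set 'I_d}).

Lemma dotC x y : dot x y = dot y x.
Proof. by apply: eq_bigr => i _; rewrite mulrC. Qed.

Lemma dotDl x y z : dot (x + y) z = dot x z + dot y z.
Proof. by rewrite -big_split; apply: eq_bigr => i _; rewrite mxE mulrDl. Qed.

Lemma dotZl a x y : dot (a *: x) y = a * dot x y.
Proof. by rewrite mulr_sumr; apply: eq_bigr => i _; rewrite mxE mulrA. Qed.

Lemma dotDr x y z : dot x (y + z) = dot x y + dot x z.
Proof. by rewrite dotC dotDl !(dotC x). Qed.

Lemma dotZr a x y : dot x (a *: y) = a * dot x y.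
Proof. by rewrite dotC dotZl dotC. Qed.

Lemma dotNl x y : dot (- x) y = - dot x y.
Proof. by rewrite -scaleN1r dotZl mulN1r. Qed.

Lemma dot0l x : dot 0 x = 0.
Proof. by rewrite -(scale0r 0) dotZl mul0r. Qed.

Lemma dot_suml n (X : 'I_n -> 'rV[R]_d) y :
  dot (\sum_i X i) y = \sum_i dot (X i) y.
Proof.
by elim/big_ind2: _ => [|x1 r1 x2 r2 <- <-|//]; rewrite ?dot0l ?dotDl.
Qed.

Lemma dotBl x y z : dot (x - y) z = dot x z - dot y z.
Proof. by rewrite dotDl dotNl. Qed.

Lemma dot_ge0 x : 0 <= dot x x.
Proof. by apply: sumr_ge0 => i _; rewrite -expr2 sqr_ge0. Qed.

Lemma dot_eq0 x : dot x x = 0 -> x = 0.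
Proof.
move=> /eqP; rewrite psumr_eq0; last by move=> i _; rewrite -expr2 sqr_ge0.
move=> /allP x0; apply/rowP => i; rewrite mxE.
by have := x0 i (mem_index_enum _); rewrite mulf_eq0 orbb => /eqP.
Qed.

Lemma enorm_ge0 x : 0 <= enorm x.
Proof. exact: sqrtr_ge0. Qed.

Lemma enorm_sqr x : enorm x ^+ 2 = dot x x.
Proof. by rewrite sqr_sqrtr ?dot_ge0. Qed.

Lemma enorm_eq0 x : enorm x = 0 -> x = 0.
Proof. by move=> x0; apply: dot_eq0; rewrite -enorm_sqr x0 expr0n. Qed.

Lemma enormZ a x : 0 <= a -> enorm (a *: x) = a * enorm x.
Proof.
move=> a0; rewrite /enorm dotZl dotZr mulrA -expr2 sqrtrM ?sqr_ge0//.
by rewrite sqrtr_sqr ger0_norm.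
Qed.

Lemma dot_subZ a x y :
  dot (x - a *: y) (x - a *: y) = dot x x - 2 * a * dot x y + a ^+ 2 * dot y y.
Proof.
rewrite dotBl !(dotC _ (_ - _)) !dotBl !dotZl !(dotC _ (a *: y)) !dotZl.
by rewrite (dotC y x); ring.
Qed.

(** Cauchy-Schwarz: the square of [enorm y *: x - enorm x *: y] expands to 2 |x| |y| (|x| |y| - <x,
    y>). *)
Lemma dot_le_enorm x y : dot x y <= enorm x * enorm y.
Proof.
have [x0|x0] := eqVneq (enorm x) 0.
  by rewrite x0 (enorm_eq0 x0) dot0l mul0r.
have [y0|y0] := eqVneq (enorm y) 0.
  by rewrite y0 (enorm_eq0 y0) dotC dot0l mulr0.
have {}x0 : 0 < enorm x by rewrite lt_def x0 enorm_ge0.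
have {}y0 : 0 < enorm y by rewrite lt_def y0 enorm_ge0.
have := dot_ge0 (enorm y *: x - enorm x *: y).
rewrite dotBl !dotZl !(dotC _ (_ - _)) !dotBl !dotZl (dotC y x).
rewrite -!enorm_sqr => h.
rewrite -subr_ge0 -(pmulr_rge0 _ (mulr_gt0 x0 y0)) -(@pmulr_rge0 _ 2)//.
by apply: le_trans h _; rewrite le_eqVlt; apply/orP; left; apply/eqP; ring.
Qed.

Lemma dot_coord_restr K x y :
  dot (coord_restr K x) y = dot (coord_restr K x) (coord_restr K y).
Proof.
apply: eq_bigr => i _; rewrite !mxE; case: ifP => //.
by rewrite !mul0r.
Qed.

Lemma coord_restrT x : coord_restr [set: 'I_d] x = x.
Proof. by apply/rowP => i; rewrite mxE inE. Qed.

Lemma coord_restrZ K a x : coord_restr K (a *: x) = a *: coord_restr K x.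
Proof. by apply/rowP => i; rewrite !mxE; case: ifP => //; rewrite mulr0. Qed.

Lemma enorm_coord_restr_le K x : enorm (coord_restr K x) <= enorm x.
Proof.
rewrite ler_sqrt ?dot_ge0//; apply: ler_sum => i _; rewrite !mxE.
by case: ifP => // _; rewrite mul0r -expr2 sqr_ge0.
Qed.

End euclidean.

(** * Top-k norms, k-support norms and their duality *)

Section topk_ksupp.
Context {R : realType} {d : nat}.
Implicit Types (x y z : 'rV[R]_d) (K : {set 'I_d}) (k l : nat).

Lemma enorm_coord_restr_le_topk k K x :
  (#|K| <= k)%N -> enorm (coord_restr K x) <= topk k x.
Proof.
move=> Kk; apply: ub_le_sup; last by exists K.
by exists (enorm x) => _ [K' _ <-]; exact: enorm_coord_restr_le.
Qed.

Lemma topk_le k x r :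
  (forall K, (#|K| <= k)%N -> enorm (coord_restr K x) <= r) -> topk k x <= r.
Proof.
move=> xr; apply: ge_sup; last by move=> _ [K Kk <-]; exact: xr.
exists (enorm (coord_restr finset.set0 x)); exists finset.set0 => //=.
by rewrite cards0.
Qed.

Lemma topk_le_enorm k x : topk k x <= enorm x.
Proof. by apply: topk_le => K _; exact: enorm_coord_restr_le. Qed.

Lemma topk_ge0 k x : 0 <= topk k x.
Proof.
apply: le_trans (enorm_ge0 (coord_restr finset.set0 x)) _.
by apply: enorm_coord_restr_le_topk; rewrite cards0.
Qed.

Lemma topk_homo k l x : (k <= l)%N -> topk k x <= topk l x.
Proof.
move=> kl; apply: topk_le => K Kk.
by apply: enorm_coord_restr_le_topk; exact: leq_trans kl.
Qed.

Lemma topk0 x : topk 0 x = 0.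
Proof.
apply/le_anti; rewrite topk_ge0 andbT; apply: topk_le => K.
rewrite leqn0 cards_eq0 => /eqP ->.
rewrite (_ : coord_restr _ _ = 0 *: x); first by rewrite enormZ// mul0r.
by apply/rowP => i; rewrite !mxE inE mul0r.
Qed.

Lemma topk_full x : topk d x = enorm x.
Proof.
apply/le_anti; rewrite topk_le_enorm -{1}(coord_restrT x).
by apply: enorm_coord_restr_le_topk; rewrite cardsT card_ord.
Qed.

Lemma topkZ_le k a x : 0 <= a -> topk k (a *: x) <= a * topk k x.
Proof.
move=> a0; apply: topk_le => K Kk; rewrite coord_restrZ enormZ//.
by rewrite ler_wpM2l// enorm_coord_restr_le_topk.
Qed.

Lemma coord_le_topk k x i : (0 < k)%N -> `|x 0 i| <= topk k x.
Proof.
move=> k0.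
apply: le_trans (_ : enorm (coord_restr (finset.set1 i) x) <= _); last first.
  by apply: enorm_coord_restr_le_topk; rewrite cards1.
rewrite /enorm /dot (bigD1 i)//= big1 ?addr0; last first.
  by move=> j ji; rewrite !mxE inE (negbTE ji) mul0r.
by rewrite !mxE inE eqxx -expr2 sqrtr_sqr.
Qed.

Lemma topk_eq0 k x : (0 < k)%N -> topk k x = 0 -> x = 0.
Proof.
move=> k0 x0; apply/rowP => i; rewrite mxE; apply/eqP.
by rewrite -normr_le0 -x0 coord_le_topk.
Qed.

(** The inequality, rather than an equality, covers x = 0, where the normalized vector is 0. *)
Lemma topk_Vtopk k x : (0 < k)%N -> topk k ((topk k x)^-1 *: x) <= 1.
Proof.
move=> k0; have [t0|t0] := eqVneq (topk k x) 0.
  by rewrite (topk_eq0 k0 t0) scaler0 -(topk_eq0 k0 t0) t0.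
by apply: le_trans (topkZ_le _ _ _) _; rewrite ?invr_ge0 ?topk_ge0// mulVf.
Qed.

Lemma coord_le_norm x i : `|x 0 i| <= `|x|.
Proof.
by rewrite [`|x|]mx_normrE (le_bigmax _ (fun ij => `|x ij.1 ij.2|) (0, i)).
Qed.

Lemma dot_le_norm_topk k x y : (0 < k)%N -> dot x y <= d%:R * `|x| * topk k y.
Proof.
move=> k0; apply: le_trans (_ : \sum_(i < d) `|x| * topk k y <= _).
  apply: ler_sum => i _; apply: le_trans (ler_norm _) _; rewrite normrM.
  by rewrite ler_pM ?coord_le_norm ?coord_le_topk.
by rewrite sumr_const card_ord -mulrA mulr_natl.
Qed.

(** For l >= 1 the set defining [ksupp l y] is bounded by d times the sup norm of y, so its supremum
    is a genuine upper bound. *)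
Lemma dot_le_ksupp_unit l x y :
  (0 < l)%N -> topk l x <= 1 -> dot x y <= ksupp l y.
Proof.
move=> l0 x1; apply: ub_le_sup; last by exists x.
exists (d%:R * `|y|) => _ [z z1 <-]; rewrite dotC.
apply: le_trans (dot_le_norm_topk _ _ l0) _.
by rewrite ler_piMr ?mulr_ge0.
Qed.

Lemma topk_zero k : topk k (0 : 'rV[R]_d) <= 0.
Proof. by have := topkZ_le k 0 (lexx 0); rewrite scale0r mul0r. Qed.

Lemma ksupp_le l y r :
  (forall x, topk l x <= 1 -> dot x y <= r) -> ksupp l y <= r.
Proof.
move=> yr; apply: ge_sup; last by move=> _ [x x1 <-]; exact: yr.
by exists (dot 0 y); exists 0 => //=; exact: le_trans (topk_zero _) ler01.
Qed.

Section positive_index.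
Variables (l : nat) (l0 : (0 < l)%N).

Lemma dot_le_ksupp x y : dot x y <= ksupp l x * topk l y.
Proof.
have [t0|t0] := eqVneq (topk l y) 0.
  by rewrite t0 (topk_eq0 l0 t0) dotC dot0l mulr0.
have {}t0 : 0 < topk l y by rewrite lt_def t0 topk_ge0.
rewrite -ler_pdivrMr// mulrC -dotZr dotC.
by rewrite dot_le_ksupp_unit// topk_Vtopk.
Qed.

Lemma ksupp_ge0 x : 0 <= ksupp l x.
Proof.
rewrite -(dot0l x) dot_le_ksupp_unit//.
exact: le_trans (topk_zero _) ler01.
Qed.

Lemma ksuppD x y : ksupp l (x + y) <= ksupp l x + ksupp l y.
Proof.
apply: ksupp_le => z z1; rewrite dotDr.
by rewrite lerD// dot_le_ksupp_unit.
Qed.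

Lemma ksuppZ_le a x : 0 <= a -> ksupp l (a *: x) <= a * ksupp l x.
Proof.
move=> a0; apply: ksupp_le => z z1; rewrite dotZr.
by rewrite ler_wpM2l// dot_le_ksupp_unit.
Qed.

Lemma ksupp0 : ksupp l (0 : 'rV[R]_d) = 0.
Proof.
apply/le_anti; rewrite ksupp_ge0 andbT.
by have := ksuppZ_le 0 (lexx 0); rewrite scale0r mul0r.
Qed.

Lemma ksupp_le_norm x : ksupp l x <= d%:R * `|x|.
Proof.
apply: ksupp_le => z z1; rewrite dotC.
apply: le_trans (dot_le_norm_topk _ _ l0) _.
by rewrite ler_piMr ?mulr_ge0.
Qed.

(** Test against the signed unit vectors, whose top-l norm is at most 1. The bound gives
    definiteness of the l-support norm and boundedness of its ball. *)
Lemma norm_le_ksupp x : `|x| <= ksupp l x.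
Proof.
rewrite [`|x|]mx_normrE; apply/bigmax_leP; split; first exact: ksupp_ge0.
move=> [k i] _ /=; rewrite (ord1 k).
have e1 b : topk l ((-1) ^+ b *: delta_mx 0 i : 'rV[R]_d) <= 1.
  apply: le_trans (topk_le_enorm _ _) _.
  rewrite -[leRHS]sqrtr1 ler_sqrt// /dot (bigD1 i)//= big1 ?addr0; last first.
    by move=> j ji; rewrite !mxE eqxx (negbTE ji) mulr0 mul0r.
  by rewrite !mxE !eqxx mulr1 -expr2 sqrr_sign.
have [b ->] : exists b, `|x 0 i| = (-1) ^+ b * x 0 i.
  by exists (x 0 i < 0)%R; rewrite -normrEsign.
apply: le_trans (dot_le_ksupp_unit x l0 (e1 b)).
rewrite dotZl /dot (bigD1 i)//= big1 ?addr0; last first.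
  by move=> j ji; rewrite !mxE eqxx (negbTE ji) mul0r.
by rewrite !mxE !eqxx mul1r.
Qed.

Lemma ksupp_eq0 x : ksupp l x = 0 -> x = 0.
Proof. by move=> x0; apply/eqP; rewrite -normr_le0 -x0 norm_le_ksupp. Qed.

Lemma ksupp_homo k x : (l <= k)%N -> ksupp k x <= ksupp l x.
Proof.
move=> lk; apply: ksupp_le => z z1; apply: dot_le_ksupp_unit => //.
exact: le_trans (topk_homo _ lk) z1.
Qed.

Lemma ksupp_Vksupp x : ksupp l ((ksupp l x)^-1 *: x) <= 1.
Proof.
have [t0|t0] := eqVneq (ksupp l x) 0.
  by rewrite (ksupp_eq0 t0) scaler0 ksupp0.
by apply: le_trans (ksuppZ_le _ _) _; rewrite ?invr_ge0 ?ksupp_ge0// mulVf.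
Qed.

Lemma continuous_ksupp : continuous (ksupp l : 'rV[R]_d -> R).
Proof.
move=> x; apply/(@cvgrPdist_le _ _ _ (nbhs x) (nbhs_filter x)) => /= e e0.
(* Subadditivity makes the norm d-Lipschitz for the sup norm. *)
have lip (u v : 'rV[R]_d) : ksupp l u - ksupp l v <= d%:R * `|u - v|.
  rewrite lerBlDr; apply: le_trans (_ : ksupp l (u - v) + ksupp l v <= _).
    by have := ksuppD (u - v) v; rewrite subrK.
  by rewrite lerD2r ksupp_le_norm.
(* The divisor d + 1 is positive even when d = 0. *)
have de : 0 < e / d.+1%:R by rewrite divr_gt0.
near=> y.
have xy : d%:R * `|x - y| <= e.
  have : `|x - y| <= e / d.+1%:R.
    by near: y; apply: (@cvgr_dist_le _ _ _ (nbhs x) _ id).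
  rewrite ler_pdivlMr// mulrC; apply: le_trans.
  by rewrite ler_wpM2r// ler_nat.
rewrite ler_norml lerNl opprB; apply/andP; split.
  by apply: le_trans (lip _ _) _; rewrite distrC.
exact: le_trans (lip _ _) xy.
Unshelve. all: by end_near. Qed.

(* The unit ball of the l-support norm contains the normalized restrictions
   y_K / |y_K|, so its support function dominates the top-l norm. *)
Lemma topk_le_support y c : (forall x, ksupp l x <= 1 -> dot y x <= c) ->
  topk l y <= c.
Proof.
move=> yc; apply: topk_le => K Kl.
set u := coord_restr K y; have [u0|u0] := eqVneq (enorm u) 0.
  by rewrite u0 -(dot0l y) dotC yc// ksupp0.
have {}u0 : 0 < enorm u by rewrite lt_def u0 enorm_ge0.
have -> : enorm u = dot y ((enorm u)^-1 *: u).
  by rewrite dotZr dotC dot_coord_restr -/u -enorm_sqr expr2 mulKf// gt_eqF.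
apply: yc; apply: ksupp_le => z z1; rewrite dotZr ler_pdivrMl// mulr1.
rewrite dotC dot_coord_restr dotC; apply: le_trans (dot_le_enorm _ _) _.
rewrite ler_piMl ?enorm_ge0//; apply: le_trans z1.
exact: enorm_coord_restr_le_topk.
Qed.

End positive_index.

(** The top-d norm is the Euclidean norm, which is its own dual: Cauchy-Schwarz one way, the duality
    inequality at y = x the other way. *)
Lemma ksupp_full x : (0 < d)%N -> ksupp d x = enorm x.
Proof.
move=> d0; apply/le_anti/andP; split.
  apply: ksupp_le => z; rewrite topk_full => z1.
  by apply: le_trans (dot_le_enorm _ _) _; rewrite ler_piMl ?enorm_ge0.
have [->|x0] := eqVneq (enorm x) 0; first exact: ksupp_ge0.
have {}x0 : 0 < enorm x by rewrite lt_def x0 enorm_ge0.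
rewrite -(ler_pM2r x0) -expr2 enorm_sqr -(topk_full x).
exact: dot_le_ksupp.
Qed.

End topk_ksupp.

(** * Convex combinations *)

Lemma convex_setP (R : realType) (M : lmodType R)
    (A : set (convex_lmodType M)) :
  convex_set A <->
  forall (x y : M) (s : R), 0 <= s <= 1 -> A x -> A y ->
    A (s *: x + (1 - s) *: y).
Proof.
split=> [cA x y s /andP[s0 s1] /mem_set Ax /mem_set Ay|cA x y s].
  by have /set_mem := cA x y (Itv01 s0 s1) Ax Ay.
move=> /set_mem Ax /set_mem Ay; apply: mem_set.
by apply: cA => //; rewrite ge0 le1.
Qed.

(** The point z takes the weight missing from 1. By induction on n, the first point is split off
    with weight a and the other weights are divided by 1 - a; if a = 1, they all vanish. *)
Lemma convex_set_sum (R : realType) (M : lmodType R)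
    (A : set (convex_lmodType M)) (z : M) n (s : 'I_n -> R) (x : 'I_n -> M) :
  convex_set A -> A z -> (forall i, A (x i)) ->
  (forall i, 0 <= s i) -> \sum_i s i <= 1 ->
  A ((1 - \sum_i s i) *: z + \sum_i s i *: x i).
Proof.
move=> /convex_setP cA Az; elim: n s x => [|n IH] s x Ax s0.
  by rewrite !big_ord0 subr0 scale1r addr0.
rewrite !big_ord_recl; set r := \sum_(i < n) s _ => s1.
have r0 : 0 <= r by exact: sumr_ge0.
have [a1|a1] := eqVneq (s ord0) 1.
  have {}r0 : r = 0.
    by apply/le_anti; rewrite r0 -(lerD2l (s ord0)) addr0 a1 -{1}a1 s1.
  have z0 i : s (lift ord0 i) = 0.
    by move/eqP: r0; rewrite psumr_eq0// => /allP/(_ i (mem_index_enum _))/eqP.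
  rewrite r0 addr0 a1 subrr scale0r add0r scale1r big1 ?addr0// => i _.
  by rewrite z0 scale0r.
set a := s ord0 in a1 s1 *.
have b0 : 0 < 1 - a by rewrite subr_gt0 lt_neqAle a1 (le_trans _ s1)// lerDl.
have -> : (1 - (a + r)) *: z + (a *: x ord0 +
      \sum_(i < n) s (lift ord0 i) *: x (lift ord0 i)) =
    a *: x ord0 + (1 - a) *:
      ((1 - \sum_(i < n) s (lift ord0 i) / (1 - a)) *: z +
      \sum_(i < n) (s (lift ord0 i) / (1 - a)) *: x (lift ord0 i)).
  rewrite -mulr_suml -/r [LHS]addrCA scalerDr scalerA; congr (_ + (_ + _)).
    by congr (_ *: _); field; rewrite gt_eqF.
  rewrite scaler_sumr; apply: eq_bigr => i _.
  by rewrite scalerA mulrC divfK// gt_eqF.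
apply: cA => //; first by rewrite s0 (le_trans _ s1)// lerDl.
apply: IH => //; first by move=> i; rewrite divr_ge0// ltW.
by rewrite -mulr_suml -/r ler_pdivrMr// mul1r lerBrDl.
Qed.

(** * [calL0] as a supremum of affine functions *)

Section calL0.
Context {R : realType} {d : nat}.
Implicit Types (x y z : 'rV[R]_d) (t : R) (X : 'I_d -> 'rV[R]_d).

(** [calL0] is the Fenchel conjugate of this function. *)
Definition calL0_conj y : R := sup [set topk l y - l%:R | l in `I_d.+1].

Lemma calL0_conj_ge l y : (l <= d)%N -> topk l y - l%:R <= calL0_conj y.
Proof.
move=> ld; apply: ub_le_sup; last by exists l.
exists (enorm y) => _ [k _ <-]; rewrite lerBlDr.
by rewrite (le_trans (topk_le_enorm _ _))// lerDl.
Qed.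

Lemma calL0_conj_le y c :
  (forall l, (l <= d)%N -> topk l y - l%:R <= c) -> calL0_conj y <= c.
Proof.
move=> yc; apply: ge_sup; last by move=> _ [l ld <-]; exact: yc.
by exists (topk 0 y - 0%:R); exists 0%N.
Qed.

Lemma calL0_conj_ge0 y : 0 <= calL0_conj y.
Proof. by apply: le_trans (calL0_conj_ge y (leq0n d)); rewrite topk0 subr0. Qed.

Lemma calL0_leP x t :
  (calL0 x <= t%:E)%E <-> forall y, dot x y - calL0_conj y <= t.
Proof.
split=> [xt y|xt].
  by rewrite -lee_fin; apply: le_trans xt; apply: ereal_sup_ubound; exists y.
by apply: ge_ereal_sup => _ [y _ <-]; rewrite lee_fin.
Qed.

Lemma calL0_ge0 x : (0 <= calL0 x)%E.
Proof.
apply: le_trans (_ : (dot x 0 - calL0_conj 0)%:E <= _)%E; last first.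
  by apply: ereal_sup_ubound; exists 0.
rewrite lee_fin dotC dot0l sub0r oppr_ge0; apply: calL0_conj_le => l _.
by rewrite lerBlDr add0r (le_trans (topk_zero _)).
Qed.

Lemma continuous_dot y : continuous (dot^~ y : 'rV[R]_d -> R).
Proof.
apply: (@continuous_big R _ +%R 0 xpredT) => [|i _ x].
  exact: add_continuous.
apply: (@continuousM _ 'rV[R]_d (fun x : 'rV[R]_d => x 0 i) (fun=> y 0 i)).
  exact: coord_continuous.
exact: cst_continuous.
Qed.

(** An affine minorant that exceeds a at x still exceeds a near x. *)
Lemma calL0_lsc : lower_semicontinuous (calL0 : 'rV[R]_d -> \bar R).
Proof.
move=> x a; rewrite ltNge => /negP/calL0_leP/existsNP[y /negP].
rewrite -ltNge => ay; exists [set z | a + calL0_conj y < dot z y].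
  have /(_ [set u | a + calL0_conj y < u]) := @continuous_dot y x.
  by apply; apply: open_nbhs_nbhs; split; [exact: open_gt|rewrite /= -ltrBrDr].
move=> z /= az; rewrite ltNge; apply/negP => /calL0_leP/(_ y).
by rewrite leNgt ltrBrDr az.
Qed.

Lemma econvex_calL0 : econvex (calL0 : 'rV[R]_d -> \bar R).
Proof.
apply/convex_setP => -[x t] [y u] s /andP[s0 s1] /= /calL0_leP xt /calL0_leP yu.
apply/calL0_leP => z /=; rewrite dotDl !dotZl -[leLHS]addr0.
have := lerD (ler_wpM2l s0 (xt z)) (ler_wpM2l (_ : 0 <= 1 - s) (yu z)).
rewrite subr_ge0 => /(_ s1); apply: le_trans.
by rewrite le_eqVlt; apply/orP; left; apply/eqP; ring.
Qed.

(** The epigraph is an intersection of closed half-spaces, one for each y. *)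
Lemma closed_epi_calL0 : closed (epi (calL0 : 'rV[R]_d -> \bar R)).
Proof.
have -> : epi calL0 = \bigcap_y [set p : 'rV[R]_d * R^o |
    dot p.1 y - p.2 <= calL0_conj y].
  apply/seteqP; split=> [[x t] /calL0_leP xt y _|[x t] xt].
    by rewrite /= lerBlDr -lerBlDl.
  by apply/calL0_leP => y; have := xt y I; rewrite /= lerBlDr -lerBlDl.
apply: closed_bigI => y _.
apply: (@preimage_closed _ _ (fun p : 'rV[R]_d * R^o => dot p.1 y - p.2)
  [set u | u <= calL0_conj y]); last exact: closed_le.
move=> p _; apply: (@continuousB _ _ _
  (fun p : 'rV[R]_d * R^o => dot p.1 y : R^o) (fun p => p.2)).
  apply: (@continuous_comp _ _ _ fst (dot^~ y)); first exact: cvg_fst.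
  exact: continuous_dot.
exact: cvg_snd.
Qed.

End calL0.

(** * Decompositions and the convex set E *)

Section decomposition.
Context {R : realType} {d : nat}.
Implicit Types (x y z : 'rV[R]_d) (t : R) (X : 'I_d -> 'rV[R]_d).

(** [X i] stands for x^(l) with l = i + 1; a family with [decomp x t X] witnesses that (x, t) lies
    in E. *)
Definition mass X : R := \sum_(i < d) ksupp i.+1 (X i).
Definition cost X : R := \sum_(i < d) i.+1%:R * ksupp i.+1 (X i).
Definition decomp x t X := [/\ mass X <= 1, \sum_(i < d) X i = x & cost X <= t].

(** Each <x^(l), y> is at most |x^(l)|_(l) |y|_(l), and |y|_(l) <= l + [calL0_conj y]. Summing gives
    the cost plus the conjugate times a mass at most 1. *)
Lemma calL0_le_decomp x t X : decomp x t X -> (calL0 x <= t%:E)%E.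
Proof.
move=> [X1 <- Xt]; apply/calL0_leP => y; rewrite lerBlDr dot_suml.
apply: le_trans (_ : cost X + calL0_conj y * mass X <= _); last first.
  by rewrite lerD// ler_piMr// calL0_conj_ge0.
rewrite mulr_sumr -big_split/=; apply: ler_sum => i _.
apply: le_trans (dot_le_ksupp (ltn0Sn i) _ _) _.
rewrite -mulrDl mulrC ler_wpM2r ?ksupp_ge0// addrC -lerBlDr.
exact: calL0_conj_ge.
Qed.

Lemma decomp_in_convex (B : set (convex_lmodType ('rV[R]_d * R^o)%type)) x t X :
  convex_set B ->
  (forall l y u, (l <= d)%N -> ksupp_ball l y -> l%:R <= u -> B (y, u)) ->
  decomp x t X -> B (x, t).
Proof.
move=> cB ballB [X1 <- Xt].
pose e := t - cost X; have e0 : 0 <= e by rewrite subr_ge0.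
have pairD1 (a b : 'rV[R]_d * R^o) : (a + b).1 = a.1 + b.1 by [].
have pairD2 (a b : 'rV[R]_d * R^o) : (a + b).2 = a.2 + b.2 by [].
(* The slack e raises all points equally, including (0, e), which takes the leftover weight; the
   combination then has height cost X + e = t. *)
have -> : (\sum_(i < d) X i, t) = ((1 - mass X) *: (0, e) +
    \sum_(i < d) ksupp i.+1 (X i) *: ((ksupp i.+1 (X i))^-1 *: X i, i.+1%:R + e)
    : 'rV[R]_d * R^o).
  apply/pair_equal_spec; split.
    rewrite (big_morph fst pairD1 (erefl _))/= scaler0 add0r.
    apply: eq_bigr => i _.
    have [k0|k0] := eqVneq (ksupp i.+1 (X i)) 0.
      by rewrite k0 scale0r (ksupp_eq0 (ltn0Sn i) k0).
    by rewrite scalerA mulfV// scale1r.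
  rewrite (big_morph snd pairD2 (erefl _))/= /GRing.scale/=.
  under eq_bigr => i _ do rewrite mulrDr.
  rewrite big_split/= -mulr_suml -/(mass X).
  rewrite (eq_bigr (fun i : 'I_d => i.+1%:R * ksupp i.+1 (X i))); last first.
    by move=> i _; rewrite mulrC.
  by rewrite -/(cost X) /e; ring.
apply: convex_set_sum => // [|i|i].
- exact: (ballB 0%N).
- by apply: (ballB i.+1) => //=; [exact: ksupp_Vksupp|rewrite lerDl].
- exact: ksupp_ge0.
Qed.

(** Sublinearity of the l-support norms lets families be combined termwise, so E is convex. *)
Lemma decomp_convex x y t u X Y (s : R) : 0 <= s <= 1 ->
  decomp x t X -> decomp y u Y ->
  decomp (s *: x + (1 - s) *: y) (s * t + (1 - s) * u)
    (fun i => s *: X i + (1 - s) *: Y i).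
Proof.
move=> /andP[s0 s1] [X1 <- Xt] [Y1 <- Yu].
have r0 : 0 <= 1 - s by rewrite subr_ge0.
have k (i : 'I_d) : ksupp i.+1 (s *: X i + (1 - s) *: Y i) <=
    s * ksupp i.+1 (X i) + (1 - s) * ksupp i.+1 (Y i).
  by apply: le_trans (ksuppD _ _ _) _; rewrite ?lerD ?ksuppZ_le.
split.
- apply: le_trans (_ : s * mass X + (1 - s) * mass Y <= _); last first.
    by apply: le_trans (lerD (ler_wpM2l s0 X1) (ler_wpM2l r0 Y1)) _; lra.
  by rewrite /mass !mulr_sumr -big_split ler_sum.
- by rewrite big_split/= -!scaler_sumr.
- apply: le_trans (lerD (ler_wpM2l s0 Xt) (ler_wpM2l r0 Yu)).
  rewrite /cost !mulr_sumr -big_split ler_sum// => i _ /=.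
  rewrite (mulrCA s) (mulrCA (1 - s)) -mulrDr.
  by rewrite ler_wpM2l.
Qed.

(** All of x goes to the term of rank l, that is index l - 1; the zero family serves for l = 0. *)
Lemma decomp_ball l x :
  (l <= d)%N -> ksupp_ball l x -> exists X, decomp x l%:R X.
Proof.
case: l => [_ /= ->|l ld /= x1].
  exists (fun=> 0); split; rewrite /mass /cost ?big1//.
  - by move=> i _; exact: ksupp0.
  - by move=> i _; rewrite ksupp0// mulr0.
pose j := Ordinal ld.
have z (i : 'I_d) : i != j -> ksupp i.+1 (if i == j then x else 0) = 0.
  by move=> /negbTE ->; exact: ksupp0.
exists (fun i => if i == j then x else 0); split.
- by rewrite /mass (bigD1 j)//= eqxx big1// addr0.
- by rewrite (bigD1 j)//= eqxx big1 ?addr0// => i /negbTE ->.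
- rewrite /cost (bigD1 j)//= eqxx big1 ?addr0 => [|i /z ->].
    by rewrite ler_piMr.
  by rewrite mulr0.
Qed.

(** * Projection onto E and separation *)

Section nearest_point.
Variables (x0 : 'rV[R]_d) (t0 : R).

(** The squared Euclidean distance to (x0, t0), quadratic along segments. *)
Let dist2 x t := dot (x0 - x) (x0 - x) + (t - t0) ^+ 2.

(** For a given family the best admissible height is the maximum of t0 and its cost, so it suffices
    to minimize over families. This choice also yields t0 <= u, which orients the hyperplane. *)
Lemma exists_nearest_decomp : exists q u,
  [/\ t0 <= u, exists X, decomp q u X &
      forall x t X, decomp x t X -> dist2 q u <= dist2 x t].
Proof.
pose T := prod_topology (fun _ : 'I_d => 'rV[R]_d).
have ck (i : 'I_d) : continuous (fun X : T => ksupp i.+1 (X i) : R).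
  move=> X; apply: (@continuous_comp _ _ _ (fun X : T => X i) (ksupp i.+1)).
    exact: (@proj_continuous 'I_d (fun=> 'rV[R]_d) i X).
  exact: continuous_ksupp.
have cx (i : 'I_d) (j : 'I_d) : continuous (fun X : T => X i 0 j : R).
  move=> X; apply: (@continuous_comp _ _ _ (fun X : T => X i)
    (fun v : 'rV[R]_d => v 0 j)).
    exact: (@proj_continuous 'I_d (fun=> 'rV[R]_d) i X).
  exact: coord_continuous.
have csum (n : nat) (F : 'I_n -> T -> R) : (forall i, continuous (F i)) ->
    continuous (fun X : T => \sum_i F i X).
  move=> cF; apply: (@continuous_big R _ +%R 0 xpredT) => //.
  exact: add_continuous.
(* A closed part of a product of unit balls, compact by Tychonoff. *)
pose A := [set X : T | forall i : 'I_d, [set v | ksupp i.+1 v <= 1] (X i)] `&`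
  [set X : T | mass X <= 1].
have cA : compact A.
  apply: compact_closedI.
    apply: (@tychonoff _ (fun=> 'rV[R]_d)
      (fun i : 'I_d => [set v | ksupp i.+1 v <= 1])) => i.
    apply: bounded_closed_compact.
      exists 1; split => // M M1 v /= v1.
      exact: le_trans (norm_le_ksupp (ltn0Sn i) v) (le_trans v1 (ltW M1)).
    apply: (@preimage_closed _ _ (ksupp i.+1) [set u : R | u <= 1]).
      by move=> v _; exact: continuous_ksupp.
    exact: closed_le.
  apply: (@preimage_closed _ _ (mass : T -> R) [set u : R | u <= 1]).
    by move=> v _; apply: csum.
  exact: closed_le.
have A0 : A !=set0.
  exists (fun=> 0); split => [i /=|/=]; first by rewrite ksupp0.
  by rewrite /mass big1// => i _; exact: ksupp0.
pose f (X : T) : R := dist2 (\sum_i X i) (Num.max t0 (cost X)).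
have cB (h g : T -> R) : continuous h -> continuous g ->
    continuous (fun X : T => h X - g X).
  by move=> ch cg X; exact: (cvgB (ch X) (cg X)).
have cM (h g : T -> R) : continuous h -> continuous g ->
    continuous (fun X : T => h X * g X).
  by move=> ch cg X; exact: (cvgM (ch X) (cg X)).
have cC (c : R) : continuous (fun _ : T => c).
  by move=> X; exact: cst_continuous.
have ccost : continuous (cost : T -> R) by apply: csum => i; exact: cM.
have cmax : continuous (fun X : T => Num.max t0 (cost X) - t0 : R).
  apply: cB => // X; apply: (@continuous_max _ _ (fun=> t0)); first exact: cC.
  exact: ccost.
have ccoord j : continuous (fun X : T => (x0 - \sum_i X i) 0 j : R).
  rewrite (_ : (fun X : T => _) = fun X : T => x0 0 j - \sum_i X i 0 j).
    by apply: cB => //; apply: csum => i; exact: cx.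
  by apply/funext => X; rewrite !mxE summxE.
have cdot := csum d _ (fun j => cM _ _ (ccoord j) (ccoord j)).
have cf : continuous f by move=> X; exact: (cvgD (cdot X) (cM _ _ cmax cmax X)).
have [X /set_mem[_ X1] Xmin] := compact_EVT_min A0 cA (continuous_subspaceT cf).
exists (\sum_i X i), (Num.max t0 (cost X)); split.
- by rewrite le_max lexx.
- by exists X; split => //; rewrite le_max lexx orbT.
move=> x t Y [Y1 <- Yt]; apply: le_trans (Xmin Y _) _.
  apply: mem_set; split => //= i; apply: le_trans Y1.
  by rewrite /mass (bigD1 i)//= lerDl sumr_ge0// => j _; exact: ksupp_ge0.
rewrite /f /dist2 lerD2l; case: (leP t0 (cost Y)) => [tY|_].
  by rewrite ler_pXn2r// ?nnegrE ?subr_ge0 ?(le_trans tY)// lerD2r.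
by rewrite subrr expr0n sqr_ge0.
Qed.

(** First-order optimality of the nearest point (q, u) along the segment to any point (x, t) of
    E. *)
Lemma exists_separation : exists q u,
  [/\ t0 <= u, exists X, decomp q u X &
      forall x t X, decomp x t X ->
        dot (x0 - q) (x - q) <= (u - t0) * (t - u)].
Proof.
have [q [u [tu [Y qu] qmin]]] := exists_nearest_decomp.
exists q, u; split; [by []|by exists Y|] => x t X xt.
set a := dot (x0 - q) (x - q) - (u - t0) * (t - u).
set b := dot (x - q) (x - q) + (t - u) ^+ 2.
have b0 : 0 <= b by rewrite addr_ge0 ?dot_ge0 ?sqr_ge0.
have ab s : 0 <= s <= 1 -> s * (2 * a) <= s * (s * b).
  move=> s01; have := qmin _ _ _ (decomp_convex s01 xt qu).
  rewrite /dist2 (_ : x0 - (s *: x + _) = (x0 - q) - s *: (x - q)); last first.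
    by apply/rowP => i; rewrite !mxE; ring.
  by rewrite dot_subZ /a /b => h; lra.
rewrite leNgt -subr_gt0 -/a; apply/negP => a0.
have ab0 : 0 < a + b by lra.
(* If a > 0, the step s = a / (a + b) would give 2 a <= s b < a. *)
have /ab : 0 <= a / (a + b) <= 1.
  by rewrite divr_ge0 ?(ltW a0) ?(ltW ab0)//= ler_pdivrMr// mul1r lerDl.
rewrite ler_pM2l ?divr_gt0// mulrAC ler_pdivlMr//.
nra.
Qed.

End nearest_point.

(** This is the inclusion of the epigraph in E. With (q, u) the projection of (x, t), the hyperplane
    is vertical exactly when u = t. *)
Lemma exists_decomp x t :
  (0 < d)%N -> (calL0 x <= t%:E)%E -> exists X, decomp x t X.
Proof.
move=> d0 /calL0_leP xt.
have [q [u [tu qu sep]]] := exists_separation x t.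
have E0 : decomp 0 0 (fun=> 0).
  split; rewrite /mass /cost ?big1//.
  - by move=> i _; exact: ksupp0.
  - by move=> i _; rewrite ksupp0// mulr0.
have [ut|ut] := eqVneq u t.
  have [->|xq] := eqVneq x q; first by rewrite -ut.
  have y0 : 0 < dot (x - q) (x - q).
    rewrite lt_def dot_ge0 andbT; apply: contra_neq xq => /dot_eq0/eqP.
    by rewrite subr_eq0 => /eqP.
  pose y := x - q.
  (* Separation bounds <y, z> by <y, q> on the ball of rank d, whose support function is the
     Euclidean norm. *)
  have yn : enorm y <= dot y q.
    rewrite -topk_full; apply: (topk_le_support d0) => z z1.
    have [X /sep] : exists X, decomp z d%:R X.
      by apply: decomp_ball => //; case: (d) d0 z z1.
    by rewrite ut subrr mul0r dotC dotBl !(dotC _ (x - q)) subr_le0.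
  (* The affine minorant of slope c y is at least c (<x, y> - |y|) >= c <y, y> at x, which is
     unbounded in c. *)
  have big c : 0 <= c -> c * dot y y <= t.
    move=> c0; apply: le_trans (xt (c *: y)); rewrite dotZr lerBrDr.
    have cy : calL0_conj (c *: y) <= c * enorm y.
      apply: calL0_conj_le => l _; rewrite -enormZ// lerBlDr.
      by rewrite (le_trans (topk_le_enorm _ _))// lerDl.
    apply: le_trans (lerD (lexx _) cy) _; rewrite -mulrDr ler_wpM2l//.
    rewrite (dotC x) -[in leRHS](subrK q x) (dotC y (x - q + q)) dotDl.
    by rewrite -/y lerD2l dotC.
  have t0 : 0 <= t by have := big 0 (lexx _); rewrite mul0r.
  have /big : 0 <= (t + 1) / dot y y by rewrite divr_ge0 ?addr_ge0// ltW.
  by rewrite divfK ?gt_eqF// gerDl ler10.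
have {}tu : 0 < u - t by rewrite subr_gt0 lt_def ut.
(* Dividing by u - t > 0 makes the hyperplane the graph of an affine function of slope y. The bounds
   below give u <= <x, y> - [calL0_conj y] <= t, a contradiction. *)
pose y := (u - t)^-1 *: (x - q).
have sep' z s X : decomp z s X -> dot y z - s <= dot y q - u.
  move=> /sep; rewrite -ler_pdivrMl// -dotZl -/y.
  by rewrite dotC dotBl !(dotC _ y) => h; lra.
have cy : calL0_conj y <= dot y q - u.
  apply: calL0_conj_le => -[_|l ld].
    by rewrite topk0 subr0; have := sep' _ _ _ E0; rewrite dotC dot0l subr0.
  rewrite lerBlDr; apply: topk_le_support => // z z1.
  have [X /sep' ] := @decomp_ball l.+1 z ld z1.
  by rewrite lerBlDr.
have yx : dot y q <= dot y x.
  rewrite -subr_ge0 !(dotC y) -dotBl dotC dotZl.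
  by rewrite mulr_ge0 ?dot_ge0// invr_ge0 ltW.
by have := xt y; rewrite dotC; lra.
Qed.

End decomposition.

(** * The three characterizations *)

Section main.
Context {R : realType} {d : nat}.
Implicit Types (x : 'rV[R]_d) (l : nat).

Lemma ksupp_ball_homo k l : (k <= l)%N ->
  (ksupp_ball k : set 'rV[R]_d) `<=` ksupp_ball l.
Proof.
case: k => [_ x /= ->|k].
  by case: l => //= l; rewrite ksupp0.
by case: l => // l kl x /=; apply: le_trans; exact: ksupp_homo.
Qed.

(** By nestedness, the index picked in [L0] is the first ball containing x. If none were picked, the
    least rank of a ball containing x would provide one. *)
Lemma L0_le l x : (l <= d)%N -> ksupp_ball l x -> (L0 x <= l%:R%:E)%E.
Proof.
move=> ld xl; rewrite /L0; case: eqVneq => [_|x0]; first by rewrite lee_fin.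
case: pickP => [i /set_mem[_ xi]|none].
  rewrite lee_fin ler_nat ltnNge; apply/negP => li.
  exact: xi (ksupp_ball_homo li xl).
have ex : exists k, x \in ksupp_ball k by exists l; exact: mem_set.
case: (ex_minnP ex) => -[/set_mem/= xE|k /set_mem xk kmin].
  by rewrite xE eqxx in x0.
have kd : (k < d)%N by exact: leq_trans (kmin _ (mem_set xl)) ld.
have /negP[] := none (Ordinal kd); apply: mem_set; split => //= xk'.
by have := kmin _ (mem_set xk'); rewrite ltnn.
Qed.

Lemma calL0_le_ball l x :
  (l <= d)%N -> ksupp_ball l x -> (calL0 x <= l%:R%:E)%E.
Proof. by move=> ld /(decomp_ball ld)[X]; exact: calL0_le_decomp. Qed.

Lemma calL0_le_L0 x : (calL0 x <= L0 x)%E.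
Proof.
rewrite /L0; case: eqVneq => [->|_]; first exact: (@calL0_le_ball 0).
by case: pickP => [i /set_mem[xi _]|_]; rewrite ?leey ?calL0_le_ball.
Qed.

(** This serves both for the closed convex hull and for the epigraph of a convex minorant of
    [L0]. *)
Lemma epi_calL0_sub_convex (B : set (convex_lmodType ('rV[R]_d * R^o)%type)) :
  (0 < d)%N -> convex_set B ->
  (forall l x u, (l <= d)%N -> ksupp_ball l x -> l%:R <= u -> B (x, u)) ->
  epi calL0 `<=` B.
Proof.
by move=> d0 cB ballB [x t] /(exists_decomp d0)[X]; exact: decomp_in_convex.
Qed.

End main.

Theorem proposition4p2 (R : realType) (d : nat) (hd : (1 <= d)%N) :
  (* 1. epigraph of calL0, with the chain of unit balls *)
  [/\ epi (@calL0 R d) =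
      closed_convex_hull
        (\bigcup_(l in `I_d.+1)
          ((ksupp_ball l : set 'rV[R]_d) `*` [set t : R^o | l%:R <= t])),
      (forall l : nat, (1 <= l < d)%N ->
        (ksupp_ball l : set 'rV[R]_d) `<=` ksupp_ball l.+1)
    & (ksupp_ball d : set 'rV[R]_d) = enorm_ball]
  /\
  (* 2. calL0 is the largest proper convex lsc function below L0 *)
  ([/\ proper_fun (@calL0 R d), econvex (@calL0 R d),
       lower_semicontinuous (@calL0 R d)
     & forall x : 'rV[R]_d, (calL0 x <= L0 x)%E]
   /\
   forall f : 'rV[R]_d -> \bar R,
     proper_fun f -> econvex f -> lower_semicontinuous f ->
     (forall x : 'rV[R]_d, (f x <= L0 x)%E) ->
     forall x : 'rV[R]_d, (f x <= calL0 x)%E)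
  /\
  (* 3. variational formula, where X i is x^(l) for l = i.+1 *)
  (forall x : 'rV[R]_d,
    is_min
      [set (\sum_(i < d) i.+1%:R * ksupp i.+1 (X i))%:E | X in
        [set X : 'I_d -> 'rV[R]_d |
          \sum_(i < d) ksupp i.+1 (X i) <= 1 /\ \sum_(i < d) X i = x]]
      (calL0 x)).
Proof.
split; [split|split].
- apply/seteqP; split.
    move=> p xt B [[_ cB] sB]; move: p xt.
    apply: epi_calL0_sub_convex => // l x u ld xl lu.
    by apply: sB; exists l.
  apply: smallest_sub.
    by split; [exact: closed_epi_calL0|exact: econvex_calL0].
  move=> [x t] [l /= ld [xl lt]]; apply: le_trans (calL0_le_ball _ xl) _ => //.
- by move=> l _; exact: ksupp_ball_homo.
- by case: d hd => // n _; apply/seteqP; split=> x /=; rewrite ksupp_full.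
- split.
    split; [split|exact: econvex_calL0|exact: calL0_lsc|exact: calL0_le_L0].
      by move=> x; rewrite gt_eqF// (lt_le_trans _ (calL0_ge0 x)).
    exists 0; rewrite lt_eqF// (le_lt_trans (@calL0_le_ball _ _ 0 _ _ _))//.
    exact: ltry.
  move=> f [_ _] cf _ fL0 x.
  (* As f <= [L0] <= l on the ball of rank l, the epigraph of f contains every piece. *)
  have sub : epi calL0 `<=` epi f.
    apply: epi_calL0_sub_convex => // l y u ld yl lu.
    apply: le_trans (fL0 y) _; apply: le_trans (L0_le ld yl) _.
    by rewrite lee_fin.
  have := calL0_ge0 x; case E : (calL0 x) => [t||] // _; last exact: leey.
  by apply: (sub (x, t)); rewrite /epi /= E.
- move=> x; split=> [[_ [X [X1 Xx] _]]|].
    have bound Y : mass Y <= 1 -> \sum_i Y i = x -> (calL0 x <= (cost Y)%:E)%E.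
      by move=> Y1 Yx; exact: (@calL0_le_decomp _ _ _ _ Y).
    split; last by move=> _ [Y [Y1 Yx] <-]; exact: bound.
    have := calL0_ge0 x; have := bound X X1 Xx.
    case E : (calL0 x) => [t||] // _ _.
    (* A family of cost at most the finite value t of [calL0 x] attains the minimum, since [bound]
       gives the reverse inequality. *)
    have [|Y [Y1 Yx Yt]] := @exists_decomp _ _ x t hd; first by rewrite E.
    exists Y => //; apply/le_anti; rewrite [X in X && _]lee_fin Yt/=.
    by rewrite -E bound.
  (* A finite value would produce an admissible family, so only +oo is left. *)
  move=> none; have := calL0_ge0 x.
  case E : (calL0 x) => [t||] // _.
  have [|Y [Y1 Yx Yt]] := @exists_decomp _ _ x t hd; first by rewrite E.
  by have : set0 (cost Y)%:E by rewrite -none; exists Y.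
Qed.
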